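(* Let $q>0$, let $\mathcal{A}=\mathbb{C}\langle x,x^*\mid xx^*=qx^*x\rangle$, and let $f\in\mathbb{R}[t]$. If $f(x^*x)\in\mathcal{A}_+$, then $f(x^*x)\in\sum\mathcal{A}^2$.
   Context: $\mathcal{A}$ is the unital complex $*$-algebra with single generator $x$ and defining relation $xx^*=qx^*x$; the set $\{x^{*m}x^n: m,n\in\mathbb{N}_0\}$ is a vector space basis of $\mathcal{A}$. $\sum\mathcal{A}^2$ denotes the set of finite sums $\sum_j a_j^*a_j$ with $a_j\in\mathcal{A}$. A densely defined operator $X$ on a Hilbert space is called $q$-normal if $\mathcal{D}(X)=\mathcal{D}(X^* )$ and $\|X^*g\|=\sqrt q\,\|Xg\|$ for all $g\in\mathcal{D}(X)$. Put $\mathcal{D}^\infty(X)=\bigcap_{n\ge1}\mathcal{D}(X^n)$. For $h=\sum_{m,n}\alpha_{mn}x^{*m}x^n\in\mathcal{A}$ write $h(X,X^* )=\sum_{m,n}\alpha_{mn}X^{*m}X^n$. An element $h=h^*\in\mathcal{A}$ belongs to $\mathcal{A}_+$ if $\langle h(X,X^* )\varphi,\varphi\rangle\ge0$ for every $q$-normal operator $X$ and every $\varphi\in\mathcal{D}^\infty(X)$. *)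

(* Defs.v *)
From HB Require Import structures.
From mathcomp Require Import all_boot all_order all_algebra.
From mathcomp Require Import complex.
From mathcomp Require Import all_classical all_reals all_analysis.
Set Implicit Arguments.
Unset Strict Implicit.
Unset Printing Implicit Defensive.
Import Order.TTheory GRing.Theory Num.Theory.
Import numFieldNormedType.Exports.
Local Open Scope classical_set_scope.
Local Open Scope ring_scope.
Local Open Scope complex_scope.

(* Formal *-algebra expressions in one generator; SCst c stands for c * 1.    *)
Inductive sexpr (C : Type) : Type :=
| SGen
| SCst of C
| SAdd of sexpr C & sexpr C
| SMul of sexpr C & sexpr C
| SStar of sexpr C.
Arguments SGen {C}.

HB.instance Definition _ (C : Type) := gen_eqMixin (sexpr C).
HB.instance Definition _ (C : Type) := gen_choiceMixin (sexpr C).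

Section Presentation.
Variables (R : realType) (q : R).
Local Notation C := R[i].
Local Notation T := (sexpr C).

(* The smallest congruence on expressions containing the axioms of unital     *)
(* complex *-algebras and the pair (x x^*, q x^* x); scalar multiplication by *)
(* c is left multiplication by SCst c.                                        *)
Inductive qcong : T -> T -> Prop :=
| qc_refl a : qcong a a
| qc_sym a b : qcong a b -> qcong b a
| qc_trans a b c : qcong a b -> qcong b c -> qcong a c
| qc_add a a' b b' : qcong a a' -> qcong b b' -> qcong (SAdd a b) (SAdd a' b')
| qc_mul a a' b b' : qcong a a' -> qcong b b' -> qcong (SMul a b) (SMul a' b')
| qc_star a a' : qcong a a' -> qcong (SStar a) (SStar a')
| qc_addA a b c : qcong (SAdd a (SAdd b c)) (SAdd (SAdd a b) c)
| qc_addC a b : qcong (SAdd a b) (SAdd b a)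
| qc_add0 a : qcong (SAdd (SCst 0) a) a
| qc_addN a : qcong (SAdd (SMul (SCst (-1)) a) a) (SCst 0)
| qc_mulA a b c : qcong (SMul a (SMul b c)) (SMul (SMul a b) c)
| qc_mul1l a : qcong (SMul (SCst 1) a) a
| qc_mul1r a : qcong (SMul a (SCst 1)) a
| qc_mulDl a b c : qcong (SMul (SAdd a b) c) (SAdd (SMul a c) (SMul b c))
| qc_mulDr a b c : qcong (SMul a (SAdd b c)) (SAdd (SMul a b) (SMul a c))
| qc_cstD c d : qcong (SCst (c + d)) (SAdd (SCst c) (SCst d))
| qc_cstM c d : qcong (SCst (c * d)) (SMul (SCst c) (SCst d))
| qc_cstC c a : qcong (SMul (SCst c) a) (SMul a (SCst c))
| qc_starD a b : qcong (SStar (SAdd a b)) (SAdd (SStar a) (SStar b))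
| qc_starM a b : qcong (SStar (SMul a b)) (SMul (SStar b) (SStar a))
| qc_starK a : qcong (SStar (SStar a)) a
| qc_starC c : qcong (SStar (SCst c)) (SCst (Num.conj c))
| qc_rel : qcong (SMul SGen (SStar SGen))
                 (SMul (SCst q%:C) (SMul (SStar SGen) SGen)).

Definition qcongb (a b : T) : bool := `[< qcong a b >].

Lemma qcongb_equiv : equiv_class_of qcongb.
Proof.
split=> [a|a b|b a c].
- exact/asboolP/qc_refl.
- by apply/asboolP/asboolP; apply: qc_sym.
- by move=> /asboolP ab /asboolP bc; apply/asboolP; apply: qc_trans bc.
Qed.

Canonical qcong_equiv := EquivRelPack qcongb_equiv.

(* Action of an expression on functions nat -> nat -> C, a function g being   *)
(* read as the formal sum of the g m n x^{*m} x^n, together with the action   *)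
(* of its adjoint.  It separates the monomials x^{*m} x^n.                    *)
Local Notation V := (nat -> nat -> C).
Let opV (g : V) : V := fun m n => if m is m'.+1 then g m' n else 0.
Let opU (g : V) : V :=
  fun m n => if n is n'.+1 then q%:C ^+ m * g m n' else 0.

Fixpoint qact (star : bool) (t : T) : V -> V :=
  match t with
  | SGen => if star then opV else opU
  | SCst c => fun g m n => (if star then Num.conj c else c) * g m n
  | SAdd a b => fun g m n => qact star a g m n + qact star b g m n
  | SMul a b => if star then qact star b \o qact star a
                else qact star a \o qact star b
  | SStar a => qact (~~ star) a
  end.

Let VP (g h : V) : (forall m n, g m n = h m n) -> g = h.
Proof. by move=> e; apply/funext => m; apply/funext => n. Qed.

Lemma qactD s t g h m n :
  qact s t (fun m n => g m n + h m n) m n = qact s t g m n + qact s t h m n.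
Proof.
have gh s' a (g' h' : V) : (forall g h m n,
   qact s' a (fun m n => g m n + h m n) m n = qact s' a g m n + qact s' a h m n)
   -> qact s' a (fun m n => g' m n + h' m n) =
      (fun m n => qact s' a g' m n + qact s' a h' m n).
  by move=> e; apply: VP.
elim: t s g h m n => [|c|a IHa b IHb|a IHa b IHb|a IHa] s g h m n /=.
- case: s; rewrite /opV /opU; first by case: m => //; rewrite addr0.
  by case: n => [|n]; [rewrite addr0 | rewrite mulrDr].
- by rewrite mulrDr.
- by rewrite IHa IHb addrACA.
- by case: s => /=; rewrite gh.
- exact: IHa.
Qed.

Lemma qactZ s t c g m n :
  qact s t (fun m n => c * g m n) m n = c * qact s t g m n.
Proof.
elim: t s c g m n => [|d|a IHa b IHb|a IHa b IHb|a IHa] s c g m n /=.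
- case: s; rewrite /opV /opU; first by case: m => //; rewrite mulr0.
  by case: n => [|n]; [rewrite mulr0 | rewrite mulrCA].
- by rewrite mulrCA.
- by rewrite IHa IHb mulrDr.
- have Z s' e (g' : V) : (forall s c g m n,
     qact s e (fun m n => c * g m n) m n = c * qact s e g m n) ->
     qact s' e (fun m n => c * g' m n) = (fun m n => c * qact s' e g' m n).
    by move=> E; apply: VP.
  by case: s => /=; rewrite Z.
- exact: IHa.
Qed.

Lemma qcong_act s a b : qcong a b -> qact s a = qact s b.
Proof.
move=> ab; elim: ab s => {a b}.
- by [].
- by move=> a b _ IH s; rewrite IH.
- by move=> a b c _ IH1 _ IH2 s; rewrite IH1.
- by move=> a a' b b' _ IH1 _ IH2 s /=; rewrite IH1 IH2.
- by move=> a a' b b' _ IH1 _ IH2 s /=; rewrite !(IH1, IH2).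
- by move=> a a' _ IH s /=; rewrite IH.
- by move=> a b c s /=; apply/funext=> g; apply: VP => m n; rewrite addrA.
- by move=> a b s /=; apply/funext=> g; apply: VP => m n; rewrite addrC.
- move=> a s /=; apply/funext=> g; apply: VP => m n.
  by case: s; rewrite ?rmorph0 mul0r add0r.
- move=> a s /=; apply/funext=> g; apply: VP => m n.
  by case: s => /=; rewrite ?qactZ ?rmorphN ?rmorph1 ?rmorph0 mulN1r mul0r addNr.
- by move=> a b c [].
- move=> a s /=; apply/funext=> g; apply: VP => m n.
  by case: s => /=; rewrite ?rmorph1 ?qactZ mul1r.
- move=> a s /=; apply/funext=> g; apply: VP => m n.
  by case: s => /=; rewrite ?rmorph1 ?qactZ mul1r.
- move=> a b c s /=; apply/funext=> g; apply: VP => m n.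
  by case: s => //=; rewrite qactD.
- move=> a b c s /=; apply/funext=> g; apply: VP => m n.
  by case: s => //=; rewrite qactD.
- move=> c d s /=; apply/funext=> g; apply: VP => m n.
  by case: s; rewrite ?rmorphD mulrDl.
- move=> c d s /=; apply/funext=> g; apply: VP => m n.
  by case: s => /=; rewrite ?rmorphM /= mulrA // [Num.conj d * _]mulrC.
- move=> c a s /=; apply/funext=> g; apply: VP => m n.
  by case: s => /=; rewrite qactZ.
- by [].
- by move=> a b [].
- by move=> a s /=; rewrite negbK.
- by move=> c s /=; apply/funext=> g; apply: VP => m n; case: s => //=; rewrite conjCK.
- move=> s /=; apply/funext=> g; apply: VP => m n.
  have qR : Num.conj q%:C = q%:C :> C by rewrite conj_Creal // complex_real.
  case: s => /=; rewrite ?qR /opU /opV; case: m n => [|m] [|n] //=.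
  + by rewrite mulr0.
  + by rewrite exprSr mulrA.
  + by rewrite mulr0.
  + by rewrite !mulr0.
  + by rewrite mulr0.
  + by rewrite exprS mulrA.
Qed.

Definition qalg : Type := {eq_quot qcongb}%qT.
HB.instance Definition _ := Choice.on qalg.
HB.instance Definition _ := EqQuotient.on qalg.

Let pi (a : T) : qalg := \pi_qalg%qT a.
Let piP a b : (pi a = pi b) <-> qcong a b.
Proof. by split=> [/eqmodP/asboolP|ab]; last exact/eqmodP/asboolP. Qed.
Let reprP a : qcong (repr (pi a)) a.
Proof. by apply/piP; rewrite /pi reprK. Qed.
Let reprK' a : pi (repr a) = a. Proof. exact: reprK. Qed.

Definition qcst (c : C) : qalg := pi (SCst c).
Definition qgen : qalg := pi SGen.
Definition qadd (a b : qalg) : qalg := pi (SAdd (repr a) (repr b)).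
Definition qmul (a b : qalg) : qalg := pi (SMul (repr a) (repr b)).
Definition star (a : qalg) : qalg := pi (SStar (repr a)).

Let qaddE a b : qadd (pi a) (pi b) = pi (SAdd a b).
Proof. by apply/piP/qc_add; apply: reprP. Qed.
Let qmulE a b : qmul (pi a) (pi b) = pi (SMul a b).
Proof. by apply/piP/qc_mul; apply: reprP. Qed.
Let starE a : star (pi a) = pi (SStar a).
Proof. by apply/piP/qc_star; apply: reprP. Qed.

Let ind (P : qalg -> Prop) : (forall a, P (pi a)) -> forall a, P a.
Proof. by move=> Pp a; rewrite -(reprK' a). Qed.

Lemma qaddA : associative qadd.
Proof.
elim/ind=> a; elim/ind=> b; elim/ind=> c; rewrite !qaddE.
exact/piP/qc_addA.
Qed.
Lemma qaddC : commutative qadd.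
Proof. by elim/ind=> a; elim/ind=> b; rewrite !qaddE; apply/piP/qc_addC. Qed.
Lemma qadd0 : left_id (qcst 0) qadd.
Proof. by elim/ind=> a; rewrite /qcst qaddE; apply/piP/qc_add0. Qed.
Lemma qaddN : left_inverse (qcst 0) (qmul (qcst (-1))) qadd.
Proof. by elim/ind=> a; rewrite /qcst qmulE qaddE; apply/piP/qc_addN. Qed.

HB.instance Definition _ :=
  GRing.isZmodule.Build qalg qaddA qaddC qadd0 qaddN.

Lemma qmulA : associative qmul.
Proof.
elim/ind=> a; elim/ind=> b; elim/ind=> c; rewrite !qmulE.
exact/piP/qc_mulA.
Qed.
Lemma qmul1l : left_id (qcst 1) qmul.
Proof. by elim/ind=> a; rewrite /qcst qmulE; apply/piP/qc_mul1l. Qed.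
Lemma qmul1r : right_id (qcst 1) qmul.
Proof. by elim/ind=> a; rewrite /qcst qmulE; apply/piP/qc_mul1r. Qed.
Lemma qmulDl : left_distributive qmul qadd.
Proof.
elim/ind=> a; elim/ind=> b; elim/ind=> c; rewrite !(qmulE, qaddE).
exact/piP/qc_mulDl.
Qed.
Lemma qmulDr : right_distributive qmul qadd.
Proof.
elim/ind=> a; elim/ind=> b; elim/ind=> c; rewrite !(qmulE, qaddE).
exact/piP/qc_mulDr.
Qed.
Lemma qone_neq0 : qcst 1 != 0.
Proof.
apply/eqP => /piP/(qcong_act false)/(congr1 (fun F => F (fun _ _ => 1) 0 0)).
by move=> /eqP; rewrite /= mulr1 mul0r oner_eq0.
Qed.

HB.instance Definition _ := GRing.Zmodule_isNzRing.Build qalg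
  qmulA qmul1l qmul1r qmulDl qmulDr qone_neq0.

Definition qscale (c : C) (a : qalg) : qalg := qcst c * a.

Lemma qcstM c d : qcst (c * d) = qcst c * qcst d.
Proof. by rewrite /GRing.mul /= /qcst qmulE; apply/piP/qc_cstM. Qed.
Lemma qcstD c d : qcst (c + d) = qcst c + qcst d.
Proof. by rewrite /GRing.add /= /qcst qaddE; apply/piP/qc_cstD. Qed.
Lemma qcst_comm c a : qcst c * a = a * qcst c.
Proof.
by elim/ind: a => a; rewrite /GRing.mul /= /qcst !qmulE; apply/piP/qc_cstC.
Qed.
Lemma qscaleA c d a : qscale c (qscale d a) = qscale (c * d) a.
Proof. by rewrite /qscale mulrA qcstM. Qed.
Lemma qscale1 : left_id 1 qscale.
Proof. exact: qmul1l. Qed.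
Lemma qscaleDr : right_distributive qscale +%R.
Proof. by move=> c a b; rewrite /qscale mulrDr. Qed.
Lemma qscaleDl a : {morph qscale^~ a : c d / c + d}.
Proof. by move=> c d; rewrite /qscale qcstD mulrDl. Qed.

HB.instance Definition _ := GRing.Zmodule_isLmodule.Build C qalg
  qscaleA qscale1 qscaleDr qscaleDl.

Lemma qscaleAl (c : C) (a b : qalg) : c *: (a * b) = (c *: a) * b.
Proof. exact: mulrA. Qed.
HB.instance Definition _ := GRing.Lmodule_isLalgebra.Build C qalg qscaleAl.

Lemma qscaleAr (c : C) (a b : qalg) : c *: (a * b) = a * (c *: b).
Proof.
by rewrite /GRing.scale /= /qscale mulrA qcst_comm -mulrA qcst_comm mulrA
   -mulrA -qcst_comm.
Qed.
HB.instance Definition _ := GRing.Lalgebra_isAlgebra.Build C qalg qscaleAr.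

Lemma starD : {morph star : a b / a + b}.
Proof.
elim/ind=> a; elim/ind=> b.
by rewrite /GRing.add /= qaddE !starE qaddE; apply/piP/qc_starD.
Qed.
Lemma starM (a b : qalg) : star (a * b) = star b * star a.
Proof.
elim/ind: a => a; elim/ind: b => b.
by rewrite /GRing.mul /= qmulE !starE qmulE; apply/piP/qc_starM.
Qed.
Lemma starK : involutive star.
Proof. by elim/ind=> a; rewrite !starE; apply/piP/qc_starK. Qed.
Lemma starZ (c : C) (a : qalg) : star (c *: a) = Num.conj c *: star a.
Proof.
rewrite /GRing.scale /= /qscale starM qcst_comm; congr (_ * _).
by rewrite /qcst starE; apply/piP/qc_starC.
Qed.
Lemma star1 : star 1 = 1.
Proof.
have : star (star 1 * 1) = star 1 * star (star 1) by rewrite starM.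
by rewrite starK !mulr1 starK.
Qed.
Lemma qgen_rel : qgen * star qgen = q%:C *: (star qgen * qgen).
Proof.
rewrite /GRing.scale /= /qscale /GRing.mul /= /qgen /qcst starE !qmulE.
exact/piP/qc_rel.
Qed.

Definition monom (m n : nat) : qalg := star qgen ^+ m * qgen ^+ n.

Definition expansion (N : nat) (alpha : nat -> nat -> C) : qalg :=
  \sum_(m < N) \sum_(n < N) alpha m n *: monom m n.

Let spanned (h : qalg) : Prop := exists N alpha, h = expansion N alpha.

Let expansion_pad N N' alpha : (N <= N')%N -> expansion N alpha =
  expansion N' (fun m n => if (m < N)%N && (n < N)%N then alpha m n else 0).
Proof.
move=> NN'; rewrite /expansion (big_ord_widen_cond N' xpredT
  (fun m => \sum_(n < N) alpha m n *: monom m n) NN') /=.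
rewrite [RHS](bigID (fun m : 'I_N' => (m < N)%N)) /=.
rewrite [X in _ = _ + X]big1 ?addr0; last first.
  by move=> m /negPf mN; rewrite big1 // => n _; rewrite mN scale0r.
apply: eq_bigr => m mN.
rewrite (big_ord_widen_cond N' xpredT (fun n => alpha m n *: monom m n) NN').
rewrite [RHS](bigID (fun n : 'I_N' => (n < N)%N)) /=.
rewrite [X in _ = _ + X]big1 ?addr0; last first.
  by move=> n /negPf nN; rewrite nN andbF scale0r.
by apply: eq_bigr => n nN; rewrite mN nN.
Qed.

Let spannedD g h : spanned g -> spanned h -> spanned (g + h).
Proof.
move=> [N [a ->]] [N' [b ->]].
rewrite (expansion_pad a (leq_maxl N N')) (expansion_pad b (leq_maxr N N')).
set a' := (fun m n => _); set b' := (fun m n => _).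
exists (maxn N N'), (fun m n => a' m n + b' m n).
rewrite /expansion -big_split /=.
apply: eq_bigr => m _; rewrite -big_split /=.
by apply: eq_bigr => n _; rewrite -scalerDl.
Qed.

Let spannedZ c h : spanned h -> spanned (c *: h).
Proof.
move=> [N [a ->]]; exists N, (fun m n => c * a m n).
rewrite /expansion scaler_sumr; apply: eq_bigr => m _.
by rewrite scaler_sumr; apply: eq_bigr => n _; rewrite scalerA.
Qed.

Let spanned_sum (I : Type) (r : seq I) (F : I -> qalg) :
  (forall i, spanned (F i)) -> spanned (\sum_(i <- r) F i).
Proof.
move=> SF; apply: (big_ind spanned) => //.
by exists 0%N, (fun _ _ => 0); rewrite /expansion big_ord0.
Qed.

Let spanned_monom k l : spanned (monom k l).
Proof.
exists (maxn k l).+1, (fun m n => ((m == k) && (n == l))%:R).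
have kN : (k < (maxn k l).+1)%N by rewrite ltnS leq_maxl.
have lN : (l < (maxn k l).+1)%N by rewrite ltnS leq_maxr.
rewrite /expansion (bigD1 (Ordinal kN)) //= (bigD1 (Ordinal lN)) //= !eqxx.
rewrite scale1r !big1 ?addr0 // => [m mk|n nl].
- by rewrite big1 // => n _; rewrite [_ == k](negPf mk) scale0r.
- by rewrite [_ == l](negPf nl) scale0r.
Qed.

Let gen_swap n m :
  qgen ^+ n * star qgen ^+ m =
  (q%:C ^+ (n * m)) *: (star qgen ^+ m * qgen ^+ n).
Proof.
have one k : qgen * star qgen ^+ k = q%:C ^+ k *: (star qgen ^+ k * qgen).
  elim: k => [|k IH]; first by rewrite !expr0 mulr1 mul1r scale1r.
  rewrite exprS mulrA qgen_rel -scalerAl -[star qgen * qgen * _]mulrA IH.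
  by rewrite -scalerAr scalerA mulrA -!exprS.
elim: n => [|n IH]; first by rewrite mul0n !expr0 mul1r mulr1 scale1r.
rewrite [in LHS]exprSr -[LHS]mulrA one -scalerAr [X in _ *: X = _]mulrA IH.
by rewrite -scalerAl scalerA -[_ * _ * qgen]mulrA -exprSr mulSn exprD.
Qed.

Let star_sum (I : Type) (r : seq I) (F : I -> qalg) :
  star (\sum_(i <- r) F i) = \sum_(i <- r) star (F i).
Proof.
have star0 : star 0 = 0.
  by apply: (addrI (star 0)); rewrite -starD !addr0.
exact: (big_morph _ starD star0).
Qed.

Let starX a n : star (a ^+ n) = star a ^+ n.
Proof.
by elim: n => [|n IH]; rewrite ?expr0 ?star1 // exprS starM IH -exprSr.
Qed.

Lemma expansion_exists (h : qalg) :
  exists N alpha, h = expansion N alpha.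
Proof.
elim/ind: h; rewrite -/(spanned _); elim=> [|c|a IHa b IHb|a IHa b IHb|a IHa].
- have -> : pi SGen = monom 0 1 by rewrite /monom expr0 mul1r.
  exact: spanned_monom.
- have -> : pi (SCst c) = c *: monom 0 0 by rewrite /monom mulr1 -[LHS]mulr1.
  exact/spannedZ/spanned_monom.
- by rewrite -qaddE; apply: spannedD.
- have -> : pi (SMul a b) = pi a * pi b by rewrite -qmulE.
  move: IHa IHb => [N [al ->]] [N' [be ->]].
  rewrite /expansion mulr_suml; apply: spanned_sum => m.
  rewrite mulr_suml; apply: spanned_sum => n.
  rewrite mulr_sumr; apply: spanned_sum => k.
  rewrite mulr_sumr; apply: spanned_sum => l.
  rewrite -scalerAl -scalerAr; do 2!apply: spannedZ.
  rewrite /monom mulrA -[_ * _ * star _ ^+ _]mulrA gen_swap.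
  rewrite -scalerAr -scalerAl; apply: spannedZ.
  by rewrite mulrA -exprD -mulrA -exprD; apply: spanned_monom.
- rewrite -starE; move: IHa => [N [al ->]].
  rewrite /expansion star_sum; apply: spanned_sum => m.
  rewrite star_sum; apply: spanned_sum => n.
  rewrite starZ; apply: spannedZ.
  by rewrite /monom starM !starX starK; apply: spanned_monom.
Qed.

Let vac : V := fun m n => ((m == 0%N) && (n == 0%N))%:R.
Let qcoef (a : qalg) : V := qact false (repr a) vac.

Let qcoefE t : qcoef (pi t) = qact false t vac.
Proof. by rewrite /qcoef (qcong_act _ (reprP t)). Qed.

Let qcoefD a b m n : qcoef (a + b) m n = qcoef a m n + qcoef b m n.
Proof. by rewrite /GRing.add /= /qadd qcoefE. Qed.

Let qcoefZ c a m n : qcoef (c *: a) m n = c * qcoef a m n.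
Proof.
elim/ind: a => a.
by rewrite /GRing.scale /= /qscale /GRing.mul /= /qcst qmulE !qcoefE.
Qed.

Let qcoef_sum (I : Type) (r : seq I) (F : I -> qalg) m n :
  qcoef (\sum_(i <- r) F i) m n = \sum_(i <- r) qcoef (F i) m n.
Proof.
apply: (big_morph (fun a => qcoef a m n)); first by move=> a b; exact: qcoefD.
by rewrite -(scale0r 0) qcoefZ mul0r.
Qed.

Let qcoef_monom k l m n : qcoef (monom k l) m n = ((m == k) && (n == l))%:R.
Proof.
have genl j m' n' : qcoef (qgen ^+ j) m' n' = ((m' == 0%N) && (n' == j))%:R.
  elim: j m' n' => [|j IH] m' n'; first by rewrite expr0 qcoefE /= mul1r.
  rewrite exprS -[qgen ^+ j]reprK' /GRing.mul /= /qgen qmulE qcoefE /=.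
  rewrite -/(qcoef _) /opU; case: n' => [|n']; first by rewrite andbF.
  rewrite IH eqSS; case: m' => [|m'] /=; last by rewrite mulr0.
  by rewrite expr0 mul1r.
rewrite /monom; elim: k m n => [|k IH] m n; first by rewrite expr0 mul1r genl.
rewrite exprS -mulrA; move: IH; set b := (_ * _) => IH.
rewrite -[b]reprK' /GRing.mul /= /qgen starE qmulE qcoefE /= -/(qcoef _) /opV.
by case: m => [|m] //; rewrite IH eqSS.
Qed.

Lemma expansion_uniq N alpha beta : expansion N alpha = expansion N beta ->
  forall m n, (m < N)%N -> (n < N)%N -> alpha m n = beta m n.
Proof.
have E al k l : (k < N)%N -> (l < N)%N -> qcoef (expansion N al) k l = al k l.
  move=> kN lN; rewrite /expansion qcoef_sum (bigD1 (Ordinal kN)) //=.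
  rewrite qcoef_sum (bigD1 (Ordinal lN)) //= qcoefZ qcoef_monom !eqxx mulr1.
  rewrite !big1 ?addr0 // => [m mk|n nl].
  - rewrite qcoef_sum big1 // => n _; rewrite qcoefZ qcoef_monom.
    by rewrite [k == _]eq_sym [_ == k](negPf mk) mulr0.
  - rewrite qcoefZ qcoef_monom [l == _]eq_sym [_ == l](negPf nl) andbF.
    by rewrite mulr0.
by move=> ab m n mN nN; rewrite -(E alpha) // ab E.
Qed.

Definition rpoly_eval (f : {poly R}) (a : qalg) : qalg :=
  horner_alg a (map_poly (real_complex R) f).

Definition sos : set qalg :=
  [set h | exists s : seq qalg, h = \sum_(a <- s) star a * a].

End Presentation.

Record hilbert (R : realType) := Hilbert {
  hsort :> completeNormedModType R[i];
  hdot : {dot hsort for Num.conj};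
  hnormE : forall u : hsort, `|u| ^+ 2 = hdot u u
}.

(* A linear operator defined on a subspace; the values of opfun outside opdom *)
(* carry no meaning.                                                          *)
Record operator (R : realType) (H : hilbert R) := Operator {
  opdom : set H;
  opfun :> H -> H;
  opdom0 : opdom 0;
  opdom_lin : forall (a : R[i]) u v, opdom u -> opdom v -> opdom (a *: u + v);
  opfun_lin : forall (a : R[i]) u v, opdom u -> opdom v ->
    opfun (a *: u + v) = a *: opfun u + opfun v
}.

Section Operators.
Variables (R : realType) (H : hilbert R) (X : operator H).
Local Notation C := R[i].

(* h is a value of the adjoint at g; unique when X is densely defined.        *)
Definition adj_value (g h : H) : Prop :=
  forall u, opdom X u -> hdot H (X u) g = hdot H u h.

Definition adjdom : set H := [set g | exists h, adj_value g h].

Definition adj (g : H) : H := xget 0 [set h | adj_value g h].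

Fixpoint powdom (n : nat) : set H :=
  if n is n'.+1 then [set u | opdom X u /\ powdom n' (X u)] else setT.

Definition domoo : set H := \bigcap_(n in [set n | (1 <= n)%N]) powdom n.

Definition qnormal (q : R) : Prop :=
  [/\ dense (opdom X), opdom X = adjdom &
      forall g, opdom X g -> `|adj g| = (Num.sqrt q)%:C * `|X g| ].

(* The operator of \sum_(m, n) alpha m n x^{*m} x^n, applied to u.            *)
Definition expansion_op (N : nat) (alpha : nat -> nat -> C) (u : H) : H :=
  \sum_(m < N) \sum_(n < N) alpha m n *: iter m adj (iter n X u).

End Operators.

(* Each h has an expansion, unique up to null coefficients, by                *)
(* expansion_exists and expansion_uniq.  The order of R[i] makes 0 <= z mean  *)
(* that z is real and nonnegative.                                            *)
Definition Aplus (R : realType) (q : R) : set (qalg q) :=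
  [set h | star h = h /\
    forall (H : hilbert R) (X : operator H), qnormal X q ->
    forall u, domoo X u ->
    forall N alpha, h = expansion q N alpha ->
      0 <= hdot H (expansion_op X N alpha u) u].

(* Main.v *)
From HB Require Import structures.
Require Import Defs.
From mathcomp Require Import all_boot all_order all_algebra.
From mathcomp Require Import complex ring lra.
From mathcomp Require Import all_classical all_reals all_analysis.
Set Implicit Arguments.
Unset Strict Implicit.
Unset Printing Implicit Defensive.
Import Order.TTheory GRing.Theory Num.Theory.
Import numFieldNormedType.Exports.
Local Open Scope classical_set_scope.
Local Open Scope ring_scope.
Local Open Scope complex_scope.

(** The idea is that the values of [f] on the open half line are diagonal matrix
    coefficients of [f(x^*x)] in suitable [q]-normal operators, so that membership
    in [A_+] forces [f >= 0] there, and that a real polynomial which is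
    nonnegative on the half line has a certificate which becomes a sum of
    hermitian squares as soon as its variable is replaced by [x^*x].

    Necessity of [f >= 0].  For [t > 0] let [X] be the bilateral weighted shift
    [X e_k = a_(k+1) e_(k+1)] on [l^2(Z)] with [a_k = sqrt t * (sqrt q)^(1-k)], on
    its maximal domain.  The recursion [a_k = sqrt q * a_(k+1)] is exactly
    [q]-normality ([shift_qnormal]).  In the algebra
    [(x^*x)^m = q^(m(m-1)/2) x^*^m x^m] ([qnormX]), while [X^*^m X^m e_0] is
    [e_0] times the product of the first [m] squared weights, that is
    [t^m q^(-m(m-1)/2)].  The powers of [q] cancel and
    [<f(X^*X) e_0, e_0> = f(t)] ([Aplus_nonneg]).  For [q <> 1] every nonzero
    [q]-normal operator is unbounded, so no finite dimensional model would do: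
    the Hilbert space [l^2(Z)] over the complex numbers is constructed here, with
    the sum of a family over the integers taken along symmetric windows.

    Certificate.  Splitting off the complex roots of [f] one real factor at a time
    writes [f] as [a * conj a + t * b * conj b] with complex polynomials [a]
    and [b] ([half_line_nonneg]); such representations are closed under products
    by a quaternionic two term identity ([half_line_certM]).  With [N = x^*x],
    which is self-adjoint, the two terms turn into [a(N)^* a(N)] and
    [(x b(N))^* (x b(N))] ([sos_half_line_cert]). *)

(** * Absolutely convergent sums over the integers *)

Section IntegerSums.
Variable R : realType.
Implicit Types f g : int -> R.

(** Both constructors of [int] are enumerated together, so that a sum over the
    integers is the limit of a single series; the partial sums run over the
    windows [-N <= i < N]. *)
Definition psum f : nat -> R := series (fun n => f (Posz n) + f (Negz n)).

Definition isum f : R := limn (psum f).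

Definition abs_summable f := exists M, forall N, psum (fun i => `|f i|) N <= M.

Lemma psumS f N : psum f N.+1 = psum f N + (f (Posz N) + f (Negz N)).
Proof. by rewrite /psum /series /= big_nat_recr. Qed.

Lemma psum0 f : psum f 0 = 0.
Proof. by rewrite /psum /series /= big_geq. Qed.

Lemma ler_psum f g N : (forall i, f i <= g i) -> psum f N <= psum g N.
Proof. by move=> fg; apply: ler_sum => n _; rewrite lerD. Qed.

Lemma psumD f g N : psum (fun i => f i + g i) N = psum f N + psum g N.
Proof. by elim: N => [|N IH]; rewrite ?psum0 ?addr0 // !psumS IH; lra. Qed.

Lemma psumZ a f N : psum (fun i => a * f i) N = a * psum f N.
Proof. by elim: N => [|N IH]; rewrite ?psum0 ?mulr0 // !psumS IH; lra. Qed.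

Lemma psum_ge0 f N : (forall i, 0 <= f i) -> 0 <= psum f N.
Proof. by move=> f0; apply: sumr_ge0 => n _; rewrite addr_ge0. Qed.

Lemma psum_nondecreasing f : (forall i, 0 <= f i) -> nondecreasing_seq (psum f).
Proof.
move=> f0; apply/nondecreasing_seqP => n.
by rewrite psumS lerDl addr_ge0.
Qed.

(** Shifting the family moves the window by one step, which exchanges its two end
    terms. *)
Lemma psum_shift f N :
  psum (fun i => f (i + 1)) N = psum f N + f (Posz N) - f (- Posz N).
Proof.
elim: N => [|N IH]; first by rewrite !psum0 oppr0 add0r subrr.
rewrite !psumS IH !NegzE -addn1 PoszD.
have -> : - (Posz N + 1) + 1 = - Posz N by ring.
lra.
Qed.

Lemma psum_le_shift f N : (forall i, 0 <= f i) ->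
  psum (fun i => f (i + 1)) N <= psum f N.+1.
Proof.
move=> f0; rewrite psum_shift psumS.
by have := f0 (- Posz N); have := f0 (Negz N); lra.
Qed.

Lemma psum_le_unshift f N : (forall i, 0 <= f i) ->
  psum f N <= psum (fun i => f (i + 1)) N.+1.
Proof.
move=> f0; rewrite psum_shift psumS NegzE.
by have := f0 (Posz N.+1); have := f0 (Posz N); lra.
Qed.

Lemma abs_summable_le f g : (forall i, `|f i| <= `|g i|) ->
  abs_summable g -> abs_summable f.
Proof.
by move=> fg [M gM]; exists M => N; apply: le_trans (ler_psum _ fg) (gM N).
Qed.

Lemma abs_summableD f g : abs_summable f -> abs_summable g ->
  abs_summable (fun i => f i + g i).
Proof.
move=> [M fM] [M' gM]; exists (M + M') => N.
apply: le_trans (lerD (fM N) (gM N)); rewrite -psumD; apply: ler_psum => i.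
exact: ler_normD.
Qed.

Lemma abs_summableZ a f : abs_summable f -> abs_summable (fun i => a * f i).
Proof.
move=> [M fM]; exists (`|a| * M) => N.
apply: le_trans (ler_wpM2l (normr_ge0 a) (fM N)).
by rewrite -psumZ; apply: ler_psum => i; rewrite normrM.
Qed.

Lemma abs_summable_shift f :
  abs_summable (fun i => f (i + 1)) <-> abs_summable f.
Proof.
split=> -[M fM]; exists M => N.
- by apply: le_trans (fM N.+1); apply: psum_le_unshift.
- by apply: le_trans (fM N.+1); apply: (psum_le_shift (f := fun i => `|f i|)).
Qed.

Lemma abs_summable_cvg f : abs_summable f -> cvgn (psum f).
Proof.
move=> [M fM]; apply: normed_cvg; apply: nondecreasing_is_cvgn.
  by apply: nondecreasing_series => n _ _; exact: normr_ge0.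
exists M => _ [N _ <-]; apply: le_trans (fM N).
by apply: ler_sum => n _; apply: ler_normD.
Qed.

Lemma isumD f g : abs_summable f -> abs_summable g ->
  isum (fun i => f i + g i) = isum f + isum g.
Proof.
move=> /abs_summable_cvg sf /abs_summable_cvg sg; rewrite /isum -limD //.
by congr (lim (_ @ \oo)); apply/funext => N; rewrite psumD.
Qed.

Lemma isumZ a f : abs_summable f -> isum (fun i => a * f i) = a * isum f.
Proof.
move=> /abs_summable_cvg sf; apply: cvg_lim => //.
have -> : psum (fun i => a * f i) = (fun N => a * psum f N).
  by apply/funext => N; rewrite psumZ.
exact: cvgMr.
Qed.

Lemma isum_ge0 f : (forall i, 0 <= f i) -> abs_summable f -> 0 <= isum f.
Proof.
move=> f0 sf; apply: limr_ge; first exact: abs_summable_cvg.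
by apply: nearW => N; apply: psum_ge0.
Qed.

Lemma ler_isum f g : abs_summable f -> abs_summable g ->
  (forall i, f i <= g i) -> isum f <= isum g.
Proof.
move=> /abs_summable_cvg sf /abs_summable_cvg sg fg; apply: ler_lim => //.
by apply: nearW => N; apply: ler_psum.
Qed.

Lemma psum_le_isum f N : (forall i, 0 <= f i) -> abs_summable f ->
  psum f N <= isum f.
Proof.
move=> f0 sf; apply: nondecreasing_cvgn_le; first exact: psum_nondecreasing.
exact: abs_summable_cvg.
Qed.

Lemma le_psum f i : (forall i, 0 <= f i) -> f i <= psum f (absz i).+1.
Proof.
move=> f0; case: i => n; rewrite psumS /=.
  by have := psum_ge0 n f0; have := f0 (Negz n); lra.
have := psum_nondecreasing f0 (leqnSn n); rewrite !psumS /=.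
have := psum_ge0 n f0; have := f0 (Posz n); have := f0 (Posz n.+1).
by have := f0 (Negz n.+1); lra.
Qed.

Lemma psum_bounded f M : (forall i, 0 <= f i) ->
  (forall N, psum f N <= M) -> abs_summable f /\ isum f <= M.
Proof.
move=> f0 fM.
have sf : abs_summable f.
  exists M => N; apply: le_trans (fM N).
  by apply: ler_psum => i; rewrite ger0_norm.
by split=> //; apply: limr_le; [exact: abs_summable_cvg|exact: nearW].
Qed.

Definition window N (i : int) : bool :=
  match i with Posz n => (n < N)%N | Negz n => (n < N)%N end.

Lemma psum_window f g N : (forall i, window N i -> f i = g i) ->
  psum f N = psum g N.
Proof.
elim: N => [|N IH] fg; first by rewrite !psum0.
rewrite !psumS !fg //=; congr (_ + _); apply: IH => i.
by case: i => n /= nN; apply: fg => /=; apply: ltnW.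
Qed.

Lemma psum_window0 f N N' : (N <= N')%N ->
  (forall i, ~~ window N i -> f i = 0) -> psum f N' = psum f N.
Proof.
move=> /subnK <- f0; elim: (N' - N)%N => [//|k IH].
by rewrite addSn psumS IH !f0 ?addr0 //= -leqNgt leq_addl.
Qed.

Lemma isum_window f N : (forall i, ~~ window N i -> f i = 0) ->
  isum f = psum f N.
Proof.
move=> f0; apply: cvg_lim => //; apply: cvg_near_cst.
by exists N => // N' /= NN'; apply: psum_window0.
Qed.

Lemma isum_single f k : (forall i, i != k -> f i = 0) -> isum f = f k.
Proof.
move=> f0; rewrite (@isum_window _ (absz k).+1); last first.
  move=> i wi; apply: f0; apply: contraNneq wi => ->.
  by case: k => n //=; rewrite ltnS.
have p0 N : ~~ window N k -> psum f N = 0.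
  move=> kN; rewrite (@psum_window _ (fun=> 0) N) => [|i iN].
    by elim: N {kN} => [|N IH]; rewrite ?psum0 // psumS IH !addr0.
  by apply: f0; apply: contraNneq kN => <-.
case: k f0 p0 => n f0 p0; rewrite /= !psumS.
  by rewrite p0 /= ?ltnn // [f (Negz n)]f0 // add0r addr0.
rewrite p0 /= ?ltnn // add0r [f (Posz n)]f0 // [f (Posz _)]f0 // add0r.
rewrite [f (Negz n.+1)]f0 ?addr0 //; apply/eqP => -[] /eqP.
by rewrite eqn_leq ltnn.
Qed.

Lemma abs_summable_norm f : abs_summable (fun i => `|f i|) <-> abs_summable f.
Proof. by split; apply: abs_summable_le => i; rewrite ?normr_id. Qed.

(** For nonnegative families the partial sums of the shifted family and of the
    family dominate each other up to one extra term, hence the two sums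
    agree; the general case follows by writing [f] as the difference of
    [f + |f|] and [|f|]. *)
Lemma isum_shift f : abs_summable f -> isum (fun i => f (i + 1)) = isum f.
Proof.
have pos g : (forall i, 0 <= g i) -> abs_summable g ->
    isum (fun i => g (i + 1)) = isum g.
  move=> g0 sg; have sg1 := (abs_summable_shift g).2 sg.
  apply/eqP; rewrite eq_le; apply/andP; split.
  - apply: (psum_bounded (fun i => g0 (i + 1)) _).2 => N.
    exact: le_trans (psum_le_shift N g0) (psum_le_isum _ g0 sg).
  - apply: (psum_bounded g0 _).2 => N.
    apply: le_trans (psum_le_unshift N g0) _.
    by apply: (@psum_le_isum (fun i => g (i + 1))).
move=> sf; have sn := (abs_summable_norm f).2 sf.
have sp := abs_summableD sf sn.
have split g : abs_summable g -> isum g =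
    isum (fun i => g i + `|g i|) - isum (fun i => `|g i|).
  by move=> sg; rewrite isumD ?addrK //; apply/abs_summable_norm.
rewrite (split _ ((abs_summable_shift f).2 sf)) (split _ sf).
rewrite (pos (fun i => f i + `|f i|)) ?(pos (fun i => `|f i|)) // => i.
by have := ler_norm (- f i); rewrite normrN; lra.
Qed.
End IntegerSums.

(** * Complex valued sums *)

Section ComplexSums.
Variable R : realType.
Local Notation C := R[i].
Implicit Types (z w : C) (F G : int -> C).

Definition sqmod z : R := complex.Re z ^+ 2 + complex.Im z ^+ 2.

Lemma sqmod_ge0 z : 0 <= sqmod z.
Proof. by rewrite addr_ge0 ?sqr_ge0. Qed.

Lemma sqmod0 : sqmod 0 = 0.
Proof. by rewrite /sqmod /=; ring. Qed.

Lemma sqmod_eq0 z : sqmod z = 0 -> z = 0.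
Proof.
move/eqP; rewrite paddr_eq0 ?sqr_ge0 // !sqrf_eq0 => /andP[/eqP a /eqP b].
by case: z a b => x y /= -> ->.
Qed.

Lemma sqmodM z w : sqmod (z * w) = sqmod z * sqmod w.
Proof. by case: z w => a b [c d]; rewrite /sqmod /=; ring. Qed.

Lemma sqmodN z : sqmod (- z) = sqmod z.
Proof. by case: z => a b; rewrite /sqmod /=; ring. Qed.

Lemma sqmod_real (x : R) : sqmod x%:C = x ^+ 2.
Proof. by rewrite /sqmod /=; ring. Qed.

Lemma mulr_conj z : z * Num.conj z = (sqmod z)%:C.
Proof. by rewrite -normCK -add_Re2_Im2. Qed.

(** The difference of the two sides is a sum of two squares divided by [s].
    Optimizing the weight [s] after summation yields the triangle inequality for
    the square sum norm, without the Cauchy-Schwarz inequality. *)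
Lemma sqmodD_le s z w : 0 < s ->
  sqmod (z + w) <= (1 + s) * sqmod z + (1 + s^-1) * sqmod w.
Proof.
have sq (x y : R) : 0 < s ->
    (x + y) ^+ 2 <= (1 + s) * x ^+ 2 + (1 + s^-1) * y ^+ 2.
  move=> s0; rewrite -subr_ge0.
  have -> : (1 + s) * x ^+ 2 + (1 + s^-1) * y ^+ 2 - (x + y) ^+ 2
      = s^-1 * (s * x - y) ^+ 2.
    by field; rewrite gt_eqF.
  by rewrite mulr_ge0 ?invr_ge0 ?sqr_ge0 // ltW.
move=> s0; case: z w => a b [c d]; rewrite /sqmod /=.
by have := sq a c s0; have := sq b d s0; lra.
Qed.

Definition csum F : C :=
  isum (fun i => complex.Re (F i)) +i* isum (fun i => complex.Im (F i)).

Definition csummable F :=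
  abs_summable (fun i => complex.Re (F i)) /\
  abs_summable (fun i => complex.Im (F i)).

Lemma csumD F G : csummable F -> csummable G ->
  csum (fun i => F i + G i) = csum F + csum G.
Proof.
move=> [rF iF] [rG iG]; rewrite /csum.
have E : forall a b c d : R, (a +i* b) + (c +i* d) = (a + c) +i* (b + d) by [].
rewrite E -!isumD //; congr (isum _ +i* isum _); apply/funext => i;
  by case: (F i) (G i) => a b [].
Qed.

Lemma csummableZ a F : csummable F -> csummable (fun i => a * F i).
Proof.
case: a => a b [rF iF]; split.
- have := abs_summableD (abs_summableZ a rF) (abs_summableZ (- b) iF).
  by congr (abs_summable _); apply/funext => i; case: (F i) => x y /=; ring.
- have := abs_summableD (abs_summableZ a iF) (abs_summableZ b rF).
  by congr (abs_summable _); apply/funext => i; case: (F i) => x y /=; ring.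
Qed.

Lemma csumZ a F : csummable F -> csum (fun i => a * F i) = a * csum F.
Proof.
case: a => a b [rF iF]; rewrite /csum.
have E : forall a b c d : R,
  (a +i* b) * (c +i* d) = (a * c + (- b) * d) +i* (a * d + b * c).
  move=> *; apply/eqP; rewrite eq_complex /=.
  by apply/andP; split; apply/eqP; ring.
rewrite E -!isumZ // -!isumD; do ?exact: abs_summableZ.
congr (isum _ +i* isum _); apply/funext => i; case: (F i) => x y /=; ring.
Qed.

Lemma csum_conj F : csummable F ->
  csum (fun i => Num.conj (F i)) = Num.conj (csum F).
Proof.
move=> [rF iF]; rewrite /csum.
have E : forall a b : R, Num.conj (a +i* b) = a +i* (- 1 * b).
  by move=> a b; rewrite mulN1r.
rewrite E -isumZ //; congr (isum _ +i* isum _); apply/funext => i.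
  by case: (F i).
by rewrite mulN1r; case: (F i).
Qed.

Lemma csum_shift F : csummable F -> csum (fun i => F (i + 1)) = csum F.
Proof.
move=> [rF iF]; congr (_ +i* _).
  exact: (isum_shift rF).
exact: (isum_shift iF).
Qed.

Lemma csum_single F k : (forall i, i != k -> F i = 0) -> csum F = F k.
Proof.
move=> F0; rewrite /csum (@isum_single _ _ k) 1?(@isum_single _ _ k).
- by case: (F k).
- by move=> i /F0 ->.
- by move=> i /F0 ->.
Qed.

Lemma csum_real (f : int -> R) : csum (fun i => (f i)%:C) = (isum f)%:C.
Proof.
by congr (_ +i* _); rewrite (@isum_window _ _ 0%N) ?psum0.
Qed.

End ComplexSums.

(** * Square summable families *)

Section SquareSummable.
Variable R : realType.
Local Notation C := R[i].

Definition l2_pred : {pred int -> C} :=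
  fun u => `[< abs_summable (fun i => sqmod (u i)) >].

Lemma l2_predP u :
  reflect (abs_summable (fun i => sqmod (u i))) (u \in l2_pred).
Proof. exact: asboolP. Qed.

Lemma l2_submod : submod_closed l2_pred.
Proof.
split=> [|a u v /l2_predP u2 /l2_predP v2]; apply/l2_predP.
  exists 0 => N; rewrite (@psum_window _ _ (fun=> 0 * 0)) => [|i _].
    by rewrite psumZ mul0r.
  by rewrite sqmod0 normr0 mul0r.
have S := abs_summableD (abs_summableZ (2 * sqmod a) u2) (abs_summableZ 2 v2).
apply: abs_summable_le S => i; rewrite !ger0_norm ?sqmod_ge0 //; last first.
  by rewrite addr_ge0 // !mulr_ge0 // sqmod_ge0.
have := @sqmodD_le _ 1 (a * u i) (v i) ltr01; rewrite invr1 sqmodM.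
by rewrite -[(a *: u + v) i]/(a * u i + v i); lra.
Qed.

HB.instance Definition _ := GRing.isSubmodClosed.Build C (int -> C) l2_pred
  l2_submod.

Record l2 : Type := L2 { l2val :> int -> C; _ : l2val \in l2_pred }.

HB.instance Definition _ := [isSub for l2val].
HB.instance Definition _ := [Choice of l2 by <:].
HB.instance Definition _ := [SubChoice_isSubLmodule of l2 by <:].

Implicit Types u v w : l2.

Lemma l2ext u v : (forall i, u i = v i) -> u = v.
Proof. by move=> uv; apply/val_inj/funext. Qed.

Lemma l2valP u : abs_summable (fun i => sqmod (u i)).
Proof. by apply/l2_predP; case: u. Qed.

Lemma csummable_mul u v : csummable (fun i => u i * Num.conj (v i)).
Proof.
have S := abs_summableD (l2valP u) (l2valP v).
have N (x a b c d : R) : `|x| <= (a ^+ 2 + b ^+ 2) + (c ^+ 2 + d ^+ 2) ->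
  `|x| <= `|sqmod (a +i* b) + sqmod (c +i* d)|.
  by rewrite (ger0_norm (addr_ge0 (sqmod_ge0 _) (sqmod_ge0 _))).
have E (a b c d : R) : (a +i* b) * Num.conj (c +i* d) =
  (a * c + b * d) +i* (b * c - a * d).
  by apply/eqP; rewrite eq_complex /=; apply/andP; split; apply/eqP; ring.
split; apply: abs_summable_le S => i; case: (u i) (v i) => a b [c d];
  rewrite E; apply: N => /=; rewrite ler_norml; apply/andP; split.
- by have := sqr_ge0 (a + c); have := sqr_ge0 (b + d); nra.
- by have := sqr_ge0 (a - c); have := sqr_ge0 (b - d); nra.
- by have := sqr_ge0 (b + c); have := sqr_ge0 (a - d); nra.
- by have := sqr_ge0 (b - c); have := sqr_ge0 (a + d); nra.
Qed.

Definition l2dot u v : C := csum (fun i => u i * Num.conj (v i)).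

Lemma l2dot_linearl v : linear_for *%R (l2dot ^~ v).
Proof.
move=> a u w.
change (l2dot (a *: u + w) v = a * l2dot u v + l2dot w v).
rewrite /l2dot -(csumZ a (csummable_mul u v)) -csumD.
- by congr csum; apply/funext => i; rewrite mulrA -mulrDl.
- exact/csummableZ/csummable_mul.
- exact: csummable_mul.
Qed.

Lemma l2dotC u v : l2dot u v = Num.conj (l2dot v u).
Proof.
rewrite /l2dot -(csum_conj (csummable_mul v u)); congr csum; apply/funext => i.
by rewrite rmorphM /= conjCK mulrC.
Qed.

Lemma l2dot_linearr u : linear_for (Num.conj \; *%R) (l2dot u).
Proof.
move=> a v w; rewrite l2dotC (l2dot_linearl u a v w) rmorphD rmorphM.
by rewrite /= -!l2dotC.
Qed.

Definition sqnorm u : R := isum (fun i => sqmod (u i)).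

Lemma sqnorm_ge0 u : 0 <= sqnorm u.
Proof. by apply: isum_ge0 (l2valP u) => i; apply: sqmod_ge0. Qed.

Lemma l2dotE u : l2dot u u = (sqnorm u)%:C.
Proof.
rewrite /l2dot /sqnorm -csum_real; congr csum; apply/funext => i.
exact: mulr_conj.
Qed.

Lemma sqmod_le_sqnorm u i : sqmod (u i) <= sqnorm u.
Proof.
have p0 j : 0 <= sqmod (u j) by apply: sqmod_ge0.
apply: le_trans (psum_le_isum _ p0 (l2valP u)).
exact: (@le_psum _ (fun j => sqmod (u j))).
Qed.

Lemma sqnorm_eq0 u : sqnorm u = 0 -> u = 0.
Proof.
move=> u0; apply: l2ext => i; apply: sqmod_eq0; apply/eqP.
by rewrite eq_le sqmod_ge0 -u0 sqmod_le_sqnorm.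
Qed.

Lemma l2dot_gt0 u : u != 0 -> 0 < l2dot u u.
Proof.
move=> u0; rewrite l2dotE ltcR lt_def sqnorm_ge0 andbT.
by apply: contraNneq u0 => /sqnorm_eq0 ->.
Qed.

HB.instance Definition _ := bilinear_isBilinear.Build C l2 l2 C *%R
  (Num.conj \; *%R) l2dot (l2dot_linearl, l2dot_linearr).

End SquareSummable.

(** * The Hilbert space of square summable families *)

Section Hilbert.
Variable R : realType.
Local Notation C := R[i].
Local Notation l2 := (l2 R).
Implicit Types u v w : l2.

Lemma l2dot_herm u v :
  l2dot u v = (-1) ^+ false * Num.conj (l2dot v u).
Proof. by rewrite mul1r -l2dotC. Qed.

HB.instance Definition _ := isHermitianSesquilinear.Build C l2 false
  (Num.conj : C -> C) (@l2dot R) l2dot_herm.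

HB.instance Definition _ := isDotProduct.Build C l2 (@l2dot R) (@l2dot_gt0 R).

Definition rnorm u : R := Num.sqrt (sqnorm u).

Lemma rnorm_ge0 u : 0 <= rnorm u.
Proof. exact: sqrtr_ge0. Qed.

Lemma sqr_rnorm u : rnorm u ^+ 2 = sqnorm u.
Proof. by rewrite sqr_sqrtr ?sqnorm_ge0. Qed.

Lemma rnorm_eq0 u : rnorm u = 0 -> u = 0.
Proof. by move=> u0; apply: sqnorm_eq0; rewrite -sqr_rnorm u0 expr0n. Qed.

Lemma rnorm_le u e : 0 <= e -> sqnorm u <= e ^+ 2 -> rnorm u <= e.
Proof.
move=> e0 ue.
by rewrite -(ler_pXn2r (n := 2)) ?nnegrE ?rnorm_ge0 // sqr_rnorm.
Qed.

Lemma sqnormZ a u : sqnorm (a *: u) = sqmod a * sqnorm u.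
Proof.
rewrite /sqnorm -isumZ; last exact: l2valP.
by congr isum; apply/funext => i; rewrite -sqmodM.
Qed.

Lemma rnormZ a u : (rnorm (a *: u))%:C = `|a| * (rnorm u)%:C.
Proof.
by rewrite /rnorm sqnormZ sqrtrM ?sqmod_ge0 // rmorphM /= normc_def.
Qed.

(** For [s = |v| / |u|] the weighted parallelogram bound is
    [(|u| + |v|)^2]. *)
Lemma rnormD u v : rnorm (u + v) <= rnorm u + rnorm v.
Proof.
have [u0|u0] := eqVneq (rnorm u) 0.
  by rewrite (rnorm_eq0 u0) add0r lerDr rnorm_ge0.
have [v0|v0] := eqVneq (rnorm v) 0.
  by rewrite (rnorm_eq0 v0) addr0 lerDl rnorm_ge0.
have {u0}u0 : 0 < rnorm u by rewrite lt_def u0 rnorm_ge0.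
have {v0}v0 : 0 < rnorm v by rewrite lt_def v0 rnorm_ge0.
apply: rnorm_le; first by rewrite addr_ge0 ?rnorm_ge0.
pose s := rnorm v / rnorm u; have s0 : 0 < s by rewrite divr_gt0.
have -> : (rnorm u + rnorm v) ^+ 2 =
    (1 + s) * sqnorm u + (1 + s^-1) * sqnorm v.
  by rewrite -!sqr_rnorm /s; field; rewrite !gt_eqF.
have su := l2valP u; have sv := l2valP v.
rewrite /sqnorm -(isumZ _ su) -(isumZ _ sv) -isumD; do ?exact: abs_summableZ.
apply: ler_isum => [||i]; first exact: (l2valP (u + v)).
- by apply: abs_summableD; apply: abs_summableZ.
- exact: sqmodD_le.
Qed.

Lemma rnormN u : rnorm (- u) = rnorm u.
Proof.
rewrite /rnorm -scaleN1r sqnormZ sqmodN.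
have -> : sqmod (1 : C) = 1 by rewrite /sqmod /=; ring.
by rewrite mul1r.
Qed.

Fact norm_triangle u v :
  (rnorm (u + v))%:C <= (rnorm u)%:C + (rnorm v)%:C :> C.
Proof. by rewrite -rmorphD lecR rnormD. Qed.

Fact norm_definite u : (rnorm u)%:C = 0 :> C -> u = 0.
Proof. by case=> /rnorm_eq0. Qed.

HB.instance Definition _ := Lmodule_isNormed.Build C l2
  norm_triangle rnormZ norm_definite.

Lemma l2normE u : `|u| = (rnorm u)%:C.
Proof. by []. Qed.

Lemma gt0_complex (e : C) : 0 < e -> exists2 r : R, 0 < r & e = r%:C.
Proof.
move=> e0; have := RRe_real (gtr0_real e0) => E.
by exists (complex.Re e) => //; rewrite -ltcR E.
Qed.

Lemma sqmod_sub_le u v i : sqmod (u i - v i) <= sqnorm (u - v).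
Proof. exact: (sqmod_le_sqnorm (u - v)). Qed.

Lemma cvg_sqmod (T : Type) (F : set_system T) (FF : Filter F)
    (f : T -> C) (l w : C) :
  (fun t => complex.Re (f t)) @ F --> complex.Re l ->
  (fun t => complex.Im (f t)) @ F --> complex.Im l ->
  (fun t => sqmod (f t - w)) @ F --> sqmod (l - w).
Proof.
have E z : sqmod (z - w) =
    (complex.Re z - complex.Re w) ^+ 2 + (complex.Im z - complex.Im w) ^+ 2.
  by case: z w => a b [].
move=> fr fi; rewrite E; under eq_fun do rewrite E.
rewrite !expr2; under eq_fun do rewrite !expr2.
by apply: cvgD; apply: cvgM; apply: cvgB => //; apply: cvg_cst.
Qed.

Lemma cvg_psum (T : Type) (F : set_system T) (FF : Filter F)
    (f : T -> int -> R) (l : int -> R) N :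
  (forall i, (fun t => f t i) @ F --> l i) ->
  (fun t => psum (f t) N) @ F --> psum l N.
Proof.
move=> fl; elim: N => [|N IH].
  by rewrite psum0; under eq_fun do rewrite psum0; apply: cvg_cst.
rewrite psumS; under eq_fun do rewrite psumS.
by apply: cvgD => //; apply: cvgD.
Qed.

(** A Cauchy filter converges coordinatewise.  A bound for the square sum of the
    distance to a fixed point passes to the coordinatewise limit, one partial sum
    at a time; this shows both that the limit is square summable and that the
    filter converges to it in norm. *)
Lemma l2_complete (F : set_system l2) : ProperFilter F -> cauchy F -> cvg F.
Proof.
move=> FF /cauchyP Fc.
have {}Fc (e : R) : 0 < e -> exists v, F [set u | rnorm (v - u) < e].
  move=> e0; have [|v Fv] := Fc e%:C; first by rewrite ltcR.
  exists v; move: Fv; rewrite -ball_normE /ball_ /=.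
  by apply: filterS => u /=; rewrite l2normE ltcR.
have coord (g : C -> R) (gB : forall a b : C, g (a - b) = g a - g b)
    (g_le : forall z, g z ^+ 2 <= sqmod z) i :
    cvg ((fun u : l2 => g (u i)) @ F).
  apply: cauchy_cvg; apply: cauchy_exP => e e0.
  have [v Fv] := Fc e e0; exists (g (v i)).
  change (F [set u : l2 | ball (g (v i)) e (g (u i))]).
  apply: filterS Fv => u /= uv.
  rewrite -ball_normE /ball_ /= -gB; apply: le_lt_trans uv.
  rewrite -(ler_pXn2r (n := 2)) ?nnegrE ?rnorm_ge0 ?normr_ge0 // sqr_rnorm.
  by rewrite real_normK ?num_real // (le_trans (g_le _)) // sqmod_sub_le.
have cr i : cvg ((fun u : l2 => complex.Re (u i)) @ F).
  by apply: coord => [[a b] [c d]|[a b]] //; rewrite /sqmod /= lerDl sqr_ge0.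
have ci i : cvg ((fun u : l2 => complex.Im (u i)) @ F).
  by apply: coord => [[a b] [c d]|[a b]] //; rewrite /sqmod /= lerDr sqr_ge0.
pose l i : C := lim ((fun u : l2 => complex.Re (u i)) @ F) +i*
                lim ((fun u : l2 => complex.Im (u i)) @ F).
have near_l e v : F [set u | rnorm (v - u) < e] ->
    forall N, psum (fun i => sqmod (l i - v i)) N <= e ^+ 2.
  move=> Fv N.
  have cv : (fun u : l2 => psum (fun i => sqmod (u i - v i)) N) @ F -->
      psum (fun i => sqmod (l i - v i)) N.
    by apply: cvg_psum => i; apply: cvg_sqmod; [exact: cr|exact: ci].
  rewrite -(cvg_lim _ cv) //; apply: limr_le; first exact: cvgP cv.
  apply: filterS Fv => u /= uv.
  have s0 i : 0 <= sqmod ((u - v) i) by exact: sqmod_ge0.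
  apply: le_trans (psum_le_isum N s0 (l2valP (u - v))) _.
  rewrite -/(sqnorm (u - v)) -sqr_rnorm -opprB rnormN.
  have e0 := le_trans (rnorm_ge0 _) (ltW uv).
  by rewrite ler_pXn2r ?nnegrE ?rnorm_ge0 // ltW.
have [v1 Fv1] := Fc 1 ltr01.
have lv1 : (fun i => l i - v1 i) \in @l2_pred R.
  apply/l2_predP; apply: (psum_bounded _ (near_l _ _ Fv1)).1 => i.
  exact: sqmod_ge0.
pose L : l2 := L2 lv1 + v1.
have LE i : L i = l i by rewrite /L /= -[LHS]/(l i - v1 i + v1 i) subrK.
apply/cvg_ex; exists L; apply/cvgrPdist_le => e /gt0_complex[r r0 ->].
have r20 : 0 < r / 2 by rewrite divr_gt0.
have [v Fv] := Fc _ r20; apply: filterS (Fv) => u /= uv.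
rewrite l2normE lecR -(subrKA v) (splitr r).
apply: le_trans (rnormD _ _) _; apply: lerD; last exact: ltW.
apply: rnorm_le; first exact: ltW.
apply: (psum_bounded _ _).2 => [i|N]; first exact: sqmod_ge0.
apply: le_trans (near_l _ _ Fv N); apply: ler_psum => i.
by rewrite -[(L - v) i]/(L i - v i) LE.
Qed.

HB.instance Definition _ := Uniform_isComplete.Build l2 l2_complete.

Lemma l2_norm_dot u : `|u| ^+ 2 = l2dot u u.
Proof. by rewrite l2normE l2dotE -sqr_rnorm rmorphXn. Qed.

Definition l2_hilbert : hilbert R :=
  @Hilbert R l2 (@l2dot R) l2_norm_dot.

End Hilbert.

(** * Finitely supported families *)

Section FiniteSupport.
Variable R : realType.
Local Notation C := R[i].
Local Notation l2 := (l2 R).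
Implicit Types (u v : l2) (f : int -> C).

Lemma l2_window f N : (forall i, ~~ window N i -> f i = 0) -> f \in @l2_pred R.
Proof.
move=> f0; apply/l2_predP; exists (psum (fun i => `|sqmod (f i)|) N) => N'.
have [NN'|/ltnW N'N] := leqP N N'.
  rewrite (psum_window0 NN') // => i /f0 ->.
  by rewrite sqmod0 normr0.
exact: (psum_nondecreasing (fun i => normr_ge0 _) N'N).
Qed.

Lemma l2_shift f : ((fun i => f (i + 1)) \in @l2_pred R) = (f \in @l2_pred R).
Proof.
have S := abs_summable_shift (fun i => sqmod (f i)).
by apply/l2_predP/l2_predP => /S.
Qed.

(** Defaults to [0] when [f] is not square summable, so that the shift can be
    given as a total function. *)
Definition mkl2 f : l2 := insubd (0 : l2) f.

Lemma mkl2E f : f \in @l2_pred R -> forall i, mkl2 f i = f i.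
Proof. by move=> f2 i; rewrite /mkl2 -[l2val _]/(val _) val_insubd f2. Qed.

Lemma l2addE u v i : (u + v) i = u i + v i. Proof. by []. Qed.
Lemma l2subE u v i : (u - v) i = u i - v i. Proof. by []. Qed.
Lemma l2scaleE (c : C) u i : (c *: u) i = c * u i. Proof. by []. Qed.

Definition trunc N f : int -> C := fun i => if window N i then f i else 0.

Lemma trunc_l2 N f : trunc N f \in @l2_pred R.
Proof. by apply: (@l2_window _ N) => i /negPf wi; rewrite /trunc wi. Qed.

Lemma sqnorm_sub_trunc N u :
  sqnorm (u - mkl2 (trunc N u)) = sqnorm u - psum (fun i => sqmod (u i)) N.
Proof.
pose t := mkl2 (trunc N u); have tE : forall i, t i = trunc N u i.
  exact/mkl2E/trunc_l2.
have -> : psum (fun i => sqmod (u i)) N = isum (fun i => sqmod (t i)).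
  rewrite (@isum_window _ _ N) => [|i /negPf wi].
    by apply: psum_window => i wi; rewrite tE /trunc wi.
  by rewrite tE /trunc wi sqmod0.
apply/esym/eqP; rewrite subr_eq; apply/eqP; rewrite -/t /sqnorm -isumD.
- congr isum; apply/funext => i; rewrite l2subE tE /trunc.
  by case: ifP => _; rewrite ?subrr ?subr0 sqmod0 ?add0r ?addr0.
- exact: (l2valP (u - t)).
- exact: l2valP.
Qed.

(** The tail [sqnorm u - psum _ N] tends to zero, so truncations of [u] come
    arbitrarily close to it. *)
Lemma dense_window (D : set l2) :
  (forall u N, (forall i, ~~ window N i -> u i = 0) -> D u) -> dense D.
Proof.
move=> DS O [u Ou] oO; have : nbhs u O by apply: open_nbhs_nbhs.
move=> /nbhs_ballP[e /= /gt0_complex[r r0 ->] uO].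
have /cvgrPdist_lt/(_ _ (exprn_gt0 2 r0)) [N _ /(_ N (leqnn N))] :=
  abs_summable_cvg (l2valP u).
rewrite -/(isum _) -/(sqnorm u) -sqnorm_sub_trunc ger0_norm ?sqnorm_ge0 //.
move=> lt.
exists (mkl2 (trunc N u)); split; last first.
  apply: (DS _ N) => i /negPf wi.
  by rewrite mkl2E ?trunc_l2 // /trunc wi.
apply: uO; rewrite -ball_normE /ball_ /= l2normE ltcR.
by rewrite -(ltr_pXn2r (n := 2)) ?nnegrE ?rnorm_ge0 ?(ltW r0) // sqr_rnorm.
Qed.

Definition delta (k : int) : l2 := mkl2 (fun i => (i == k)%:R).

Lemma delta_window k i : ~~ window (absz k).+1 i -> (i == k) = false.
Proof. by apply: contraNF => /eqP ->; case: k => n /=; rewrite ?ltnS. Qed.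

Lemma deltaE k i : delta k i = (i == k)%:R.
Proof.
apply: (mkl2E (f := fun i => (i == k)%:R)).
by apply: (@l2_window _ (absz k).+1) => j /delta_window ->.
Qed.

Lemma l2dot_deltal k u : l2dot (delta k) u = Num.conj (u k).
Proof.
rewrite /l2dot (@csum_single _ _ k) ?deltaE ?eqxx ?mul1r // => i /negPf ik.
by rewrite deltaE ik mul0r.
Qed.

End FiniteSupport.

(** * The bilateral weighted shift *)

Section WeightedShift.
Variables (R : realType) (r : R) (a : int -> R).
Hypotheses (r_gt0 : 0 < r) (a_rec : forall i, a i = r * a (i + 1)).
Local Notation C := R[i].
Local Notation H := (l2_hilbert R).
Implicit Types u v : H.

Let scaled (u : int -> C) : int -> C := fun i => (a i)%:C * u i.
Let up (u : int -> C) : int -> C := fun i => (a i)%:C * u (i - 1).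
Let down (u : int -> C) : int -> C := fun i => (a (i + 1))%:C * u (i + 1).

(** The maximal domain.  Since consecutive weights have a constant ratio, it is
    the natural domain both of the shift and of its adjoint. *)
Definition shift_dom : set H := [set u | scaled u \in @l2_pred R].

Let downP u : (down u \in @l2_pred R) = (scaled u \in @l2_pred R).
Proof. exact: (l2_shift (scaled u)). Qed.

Let up_shift u i : up u (i + 1) = (r^-1)%:C * scaled u i.
Proof.
rewrite /up /scaled addrK (a_rec i) mulrA -rmorphM /=.
by rewrite mulrA mulVf ?mul1r ?gt_eqF.
Qed.

Let upP u : shift_dom u -> up u \in @l2_pred R.
Proof.
move=> Du; rewrite -(l2_shift (up u)).
have -> : (fun i => up u (i + 1)) = (r^-1)%:C *: scaled u.
  by apply/funext => i; rewrite up_shift.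
exact: rpredZ.
Qed.

Let scaled_lin (c : C) u v : scaled (c *: u + v) = c *: scaled u + scaled v.
Proof.
apply/funext => i; rewrite /scaled.
by rewrite -[RHS]/(c * scaled u i + scaled v i) /scaled mulrDr mulrCA.
Qed.

Let shift_dom0 : shift_dom 0.
Proof.
rewrite /shift_dom /=; have -> : scaled (0 : H) = 0; last exact: rpred0.
by apply/funext => i; rewrite /scaled mulr0.
Qed.

Let shift_dom_lin (c : C) u v : shift_dom u -> shift_dom v ->
  shift_dom (c *: u + v).
Proof. by move=> Du Dv; rewrite /shift_dom /= scaled_lin rpredD ?rpredZ. Qed.

Definition shift_fun u : H := mkl2 (up u).

Let shift_fun_lin (c : C) u v : shift_dom u -> shift_dom v ->
  shift_fun (c *: u + v) = c *: shift_fun u + shift_fun v.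
Proof.
move=> Du Dv; apply: l2ext => i; rewrite l2addE l2scaleE !mkl2E ?upP //.
  by rewrite /up l2addE l2scaleE mulrDr mulrCA.
exact: shift_dom_lin.
Qed.

Definition shift_op : operator H :=
  Operator shift_dom0 shift_dom_lin shift_fun_lin.

Let shift_dom_delta k : shift_dom (delta R k).
Proof.
apply: (@l2_window _ _ (absz k).+1) => i /delta_window ik.
by rewrite /scaled deltaE ik mulr0.
Qed.

Let shift_funE u i : shift_dom u -> shift_fun u i = up u i.
Proof. by move=> Du; rewrite mkl2E // upP. Qed.

(** Testing the adjoint relation on the basis vectors forces the value of the
    adjoint coordinate by coordinate; conversely the relation is a reindexing
    of the sum defining the inner product. *)
Lemma shift_adj_value u v :
  adj_value shift_op u v <-> shift_dom u /\ v = mkl2 (down u).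
Proof.
split=> [adj|[Du ->] w Dw].
- have vE : (v : int -> C) = down u.
    apply/funext => k; have := adj (delta R k) (shift_dom_delta k).
    rewrite /= l2dot_deltal /l2dot (@csum_single _ _ (k + 1)) => [|i ik].
      rewrite shift_funE ?shift_dom_delta // /up addrK deltaE eqxx mulr1.
      move=> /esym/(congr1 Num.conj); rewrite conjCK rmorphM /= conjCK => ->.
      by rewrite conj_Creal // complex_real.
    rewrite shift_funE ?shift_dom_delta // /up deltaE.
    by rewrite (_ : (_ == k) = false) ?mulr0 ?mul0r // subr_eq (negPf ik).
  have Du : shift_dom u by rewrite /shift_dom /= -downP -vE; case: (v).
  by split=> //; apply: l2ext => i; rewrite mkl2E ?downP ?vE.
- rewrite /= /l2dot -(csum_shift (csummable_mul (shift_fun w) u)).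
  congr csum; apply/funext => i; rewrite shift_funE // mkl2E ?downP //.
  rewrite /up /down addrK rmorphM /= [Num.conj (a _)%:C]conj_Creal; last first.
    by rewrite complex_real.
  by rewrite mulrA [w i * _]mulrC.
Qed.

Lemma shift_adjE u : shift_dom u -> adj shift_op u = mkl2 (down u).
Proof.
move=> Du; apply: xget_unique; first exact/shift_adj_value.
by move=> v /shift_adj_value[].
Qed.

(** After a reindexing, the squared norms of [X u] and of its adjoint at [u] are
    sums of the same terms [(a i)^2 |u_i|^2], up to the factor [r ^ 2 = q]. *)
Lemma shift_qnormal q : 0 < q -> r = Num.sqrt q -> qnormal shift_op q.
Proof.
move=> q0 rq; split.
- apply: dense_window => u N uN; apply: (@l2_window _ _ N) => i /uN ui.
  by rewrite /scaled ui mulr0.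
- apply/seteqP; split=> u /=; last by move=> [v /shift_adj_value[]].
  by move=> Du; exists (mkl2 (down u)); apply/shift_adj_value.
- move=> u Du; rewrite shift_adjE // !l2normE -rq -rmorphM; congr (_%:C).
  have E : sqnorm (mkl2 (down u)) = r ^+ 2 * sqnorm (shift_fun u).
    have /l2_predP su := Du.
    rewrite /sqnorm -isumZ; last exact: l2valP.
    rewrite -[RHS](isum_shift (abs_summableZ _ (l2valP _))).
    have -> : (fun i => sqmod (mkl2 (down u) i)) =
        (fun i => sqmod (scaled u (i + 1))).
      by apply/funext => i; rewrite mkl2E // downP.
    rewrite (isum_shift su); congr isum; apply/funext => i.
    rewrite shift_funE // up_shift sqmodM sqmod_real exprVn mulrA.
    by rewrite divff ?mul1r // expf_eq0 /= gt_eqF.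
  by rewrite /rnorm E sqrtrM ?sqr_ge0 // sqrtr_sqr gtr0_norm.
Qed.

Let shift_dom_scale (c : C) k : shift_dom (c *: delta R k).
Proof.
by rewrite -[_ *: _]addr0; exact: shift_dom_lin (shift_dom_delta k) shift_dom0.
Qed.

Lemma shift_delta c k :
  shift_op (c *: delta R k) = (c * (a (k + 1))%:C) *: delta R (k + 1).
Proof.
apply: l2ext => i; rewrite (shift_funE i (shift_dom_scale c k)) /up !l2scaleE.
rewrite !deltaE subr_eq; case: eqP => [->|_]; last by rewrite mulr0n !mulr0.
by rewrite !mulr1 mulrC.
Qed.

Lemma shift_adj_delta c k :
  adj shift_op (c *: delta R (k + 1)) = (c * (a (k + 1))%:C) *: delta R k.
Proof.
rewrite (shift_adjE (shift_dom_scale _ _)); apply: l2ext => i.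
rewrite mkl2E; last by rewrite downP; apply: shift_dom_scale.
rewrite /down !l2scaleE !deltaE (inj_eq (addIr 1)).
case: eqP => [->|_]; last by rewrite mulr0n !mulr0.
by rewrite !mulr1 mulrC.
Qed.

Lemma shift_domoo k : domoo shift_op (delta R k).
Proof.
move=> n _; rewrite -[delta _ _]scale1r; move: (1 : C) => c.
elim: n c k => [//|n IH] c k; split; first exact: shift_dom_scale.
by rewrite shift_delta; apply: IH.
Qed.

Lemma shift_iter n : iter n shift_op (delta R 0) =
  (\prod_(j < n) a (Posz j + 1))%:C *: delta R (Posz n).
Proof.
elim: n => [|n IH]; first by rewrite big_ord0 scale1r.
rewrite iterS IH shift_delta big_ord_recr /= rmorphM /=.
by rewrite -addn1 PoszD.
Qed.

Lemma shift_adj_iter c n : iter n (adj shift_op) (c *: delta R (Posz n)) =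
  (c * (\prod_(j < n) a (Posz j + 1))%:C) *: delta R 0.
Proof.
elim: n c => [|n IH] c; first by rewrite big_ord0 mulr1.
rewrite iterSr -addn1 PoszD shift_adj_delta IH addn1 big_ord_recr /= rmorphM /=.
by rewrite -mulrA [X in c * X]mulrC.
Qed.

(** The operator attached to a polynomial in the [x^*^m x^m] acts on the basis
    vector [e_0] as a scalar. *)
Lemma shift_expansion N (beta : nat -> R) :
  expansion_op shift_op N (fun m n => if m == n then (beta m)%:C else 0)
    (delta R 0) =
  (\sum_(m < N) beta m * (\prod_(j < m) a (Posz j + 1)) ^+ 2)%:C *: delta R 0.
Proof.
rewrite /expansion_op rmorph_sum scaler_suml; apply: eq_bigr => m _.
rewrite (bigD1 m) //= eqxx big1 ?addr0 => [|n nm]; last first.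
  by rewrite ifN ?scale0r // eq_sym.
by rewrite shift_iter shift_adj_iter scalerA -rmorphM -rmorphM.
Qed.

Lemma shift_dot_delta (c : C) : hdot H (c *: delta R 0) (delta R 0) = c.
Proof.
rewrite /= l2dotC l2dot_deltal conjCK l2scaleE deltaE eqxx.
exact: mulr1.
Qed.

End WeightedShift.

(** * Nonnegativity on the half line is necessary *)

Section Necessity.
Variables (R : realType) (q : R).
Local Notation C := R[i].
Local Notation x := (qgen q).
Local Notation A := (qalg q).

Lemma qgenX_star n : x ^+ n * star x = q%:C ^+ n *: (star x * x ^+ n).
Proof.
elim: n => [|n IH]; first by rewrite !expr0 mul1r mulr1 scale1r.
rewrite exprSr -mulrA qgen_rel -scalerAr (mulrA (x ^+ n)) IH -scalerAl scalerA.
by rewrite -exprS -mulrA -exprSr.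
Qed.

Lemma qnormX m : (star x * x) ^+ m = q%:C ^+ 'C(m, 2) *: monom q m m.
Proof.
elim: m => [|m IH]; first by rewrite /monom !expr0 mulr1 scale1r.
rewrite exprSr IH /monom -scalerAl mulrA -(mulrA (star x ^+ m)) qgenX_star.
rewrite -scalerAr -scalerAl scalerA -exprD binS bin1 (mulrA (star x ^+ m)).
by rewrite -exprSr -mulrA -exprSr.
Qed.

Lemma rpoly_eval_expansion (f : {poly R}) :
  rpoly_eval f (star x * x) = expansion q (size f)
    (fun m n => if m == n then (f`_m * q ^+ 'C(m, 2))%:C else 0).
Proof.
rewrite /rpoly_eval /expansion.
have -> : map_poly (real_complex R) f = \sum_(m < size f) (f`_m)%:C *: 'X^m.
  rewrite -(poly_def _ (fun m => (f`_m)%:C)).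
  by apply/polyP => m; rewrite coef_map.
rewrite linear_sum /=; apply: eq_bigr => m _.
rewrite (bigD1 m) //= eqxx big1 ?addr0 => [|n nm]; last first.
  by rewrite ifN ?scale0r // eq_sym.
rewrite linearZ rmorphXn /= horner_algX qnormX mulr_algl scalerA.
by rewrite rmorphM rmorphXn.
Qed.

(** The shift realizes [x^*x] with [e_0] as eigenvector of eigenvalue [t]. *)
Lemma Aplus_nonneg (f : {poly R}) : 0 < q ->
  Aplus (rpoly_eval f (star x * x)) -> forall t, 0 < t -> 0 <= f.[t].
Proof.
move=> q0 [_ fA] t t0.
pose r := Num.sqrt q; have r0 : 0 < r by rewrite sqrtr_gt0.
pose a (i : int) : R := Num.sqrt t * r ^ (1 - i).
have a_rec i : a i = r * a (i + 1).
  rewrite /a mulrCA; congr (_ * _).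
  have -> : 1 - i = 1 + (1 - (i + 1)) by ring.
  by rewrite expfzDr ?gt_eqF // expr1z.
have := fA _ _ (shift_qnormal r0 a_rec q0 erefl) _ (shift_domoo r0 a_rec 0)
  _ _ (rpoly_eval_expansion f).
rewrite shift_expansion shift_dot_delta ler0c; congr (_ <= _).
rewrite horner_coef; apply: eq_bigr => m _; rewrite -mulrA; congr (_ * _).
elim: (m : nat) => [|n IH]; first by rewrite big_ord0 expr1n mulr1.
rewrite binS bin1 exprD big_ord_recr /= exprMn [RHS]exprSr -IH.
have -> : t = q ^+ n * a (Posz n + 1) ^+ 2; last by ring.
rewrite /a exprMn sqr_sqrtr ?ltW // mulrCA.
have -> : 1 - (Posz n + 1) = - Posz n by ring.
rewrite -exprnN exprVn -exprM mulnC exprM sqr_sqrtr ?ltW // divff ?mulr1 //.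
by rewrite expf_eq0 gt_eqF ?andbF.
Qed.

End Necessity.

(** * Polynomials nonnegative on the half line *)

Section NonnegPolynomials.
Variable R : realType.
Local Notation C := R[i].
Local Notation cpoly := (map_poly (real_complex R)).
Local Notation pconj := (map_poly (@Num.conj C)).

(** A representation of [f(t)] as [|a(t)|^2 + t |b(t)|^2], which makes its
    nonnegativity for [t >= 0] evident. *)
Definition half_line_cert (f : {poly R}) : Prop :=
  exists a b : {poly C}, cpoly f = a * pconj a + 'X * (b * pconj b).

Lemma conj_polyK (p : {poly C}) : pconj (pconj p) = p.
Proof. by apply/polyP => i; rewrite !coef_map /= conjCK. Qed.

(** [(|a|^2 + t |b|^2) (|c|^2 + t |d|^2)] equals
    [|a c - t b conj d|^2 + t |a d + b conj c|^2], because the cross terms cancel: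
    this is the multiplicativity of the quaternion norm. *)
Lemma half_line_certM f g :
  half_line_cert f -> half_line_cert g -> half_line_cert (f * g).
Proof.
move=> [a [b fE]] [c [d gE]].
exists (a * c - 'X * (b * pconj d)), (a * d + b * pconj c).
rewrite rmorphM /= fE gE rmorphB !rmorphD !rmorphM /= !conj_polyK map_polyX.
ring.
Qed.

Lemma half_line_certC (c : R) : 0 <= c -> half_line_cert c%:P.
Proof.
move=> c0; exists ((Num.sqrt c)%:C)%:P, 0.
rewrite mul0r mulr0 addr0 !map_polyC /= conj_Creal ?complex_real // -polyCM.
by rewrite -rmorphM -expr2 sqr_sqrtr.
Qed.

Lemma half_line_cert_lin (c : R) : c <= 0 -> half_line_cert ('X - c%:P).
Proof.
move=> c0; exists ((Num.sqrt (- c))%:C)%:P, 1.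
rewrite rmorph1 !mulr1 rmorphB /= map_polyX !map_polyC /=.
rewrite conj_Creal ?complex_real // -polyCM -rmorphM -expr2.
by rewrite sqr_sqrtr ?oppr_ge0 // rmorphN polyCN addrC.
Qed.

Lemma half_line_cert_sqr (p : {poly R}) : half_line_cert (p ^+ 2).
Proof.
exists (cpoly p), 0; rewrite mul0r mulr0 addr0 rmorphXn /= expr2; congr (_ * _).
by apply/polyP => i; rewrite !coef_map /= conj_Creal ?complex_real.
Qed.

Definition conj_quad (z : C) : {poly R} :=
  'X^2 - (complex.Re z *+ 2)%:P * 'X + (sqmod z)%:P.

Lemma conj_quadE z : cpoly (conj_quad z) = ('X - z%:P) * ('X - (Num.conj z)%:P).
Proof.
rewrite /conj_quad rmorphD rmorphB rmorphXn rmorphM /= map_polyX !map_polyC /=.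
have -> : (sqmod z)%:C = z * Num.conj z by rewrite mulr_conj.
have -> : (complex.Re z *+ 2)%:C = z + Num.conj z.
  case: z => a b; apply/eqP; rewrite eq_complex /=.
  by apply/andP; split; apply/eqP; ring.
rewrite polyCM polyCD; ring.
Qed.

Lemma half_line_cert_quad z : half_line_cert (conj_quad z).
Proof.
exists ('X - z%:P), 0; rewrite mul0r mulr0 addr0 conj_quadE.
by rewrite rmorphB /= map_polyX map_polyC.
Qed.

Lemma conj_quad_gt0 z t : complex.Im z != 0 -> 0 < (conj_quad z).[t].
Proof.
have -> : (conj_quad z).[t] = (t - complex.Re z) ^+ 2 + complex.Im z ^+ 2.
  rewrite /conj_quad !(hornerD, hornerN, hornerM, hornerXn, hornerX, hornerC).
  by rewrite /sqmod; ring.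
by move=> z0; rewrite ltr_wpDl ?sqr_ge0 // exprn_even_gt0.
Qed.

Lemma conj_quad_dvd (f : {poly R}) z : complex.Im z != 0 -> root (cpoly f) z ->
  conj_quad z %| f.
Proof.
move=> z0 fz; rewrite -(dvdp_map (real_complex R)) /= conj_quadE.
have zz : z != Num.conj z.
  apply: contra z0 => /eqP; case: (z) => a b [] /eqP.
  by rewrite -subr_eq0 opprK -mulr2n mulrn_eq0.
rewrite Gauss_dvdp; last by rewrite coprimep_XsubC root_XsubC eq_sym.
rewrite !dvdp_XsubCl fz /=.
have := fz; rewrite -(fmorph_root (@Num.conj C)) /=; congr (root _ _).
by apply/polyP => i; rewrite !coef_map /= conj_Creal ?complex_real.
Qed.

Lemma horner_ge0_right (p : {poly R}) (s : R) :
  (forall t, s < t -> 0 <= p.[t]) -> 0 <= p.[s].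
Proof.
move=> ps; have cp := cvg_at_right_filter (@continuous_horner R p s).
rewrite -(cvg_lim _ cp) //.
apply: limr_ge; first exact: cvgP cp.
by near=> t; apply: ps.
Unshelve. all: by end_near. Qed.

Lemma horner_le0_left (p : {poly R}) (s : R) : 0 < s ->
  (forall t, 0 < t < s -> p.[t] <= 0) -> p.[s] <= 0.
Proof.
move=> s0 ps; have cp := cvg_at_left_filter (@continuous_horner R p s).
rewrite -(cvg_lim _ cp) //.
apply: limr_le; first exact: cvgP cp.
near=> t; apply: ps; apply/andP; split; last by near: t; exact: nbhs_left_lt.
by near: t; apply: nbhs_left_gt.
Unshelve. all: by end_near. Qed.

(** By induction on the degree, splitting off the real factor that belongs to a
    complex root: a nonreal root comes with its conjugate, a root [s <= 0] gives
    the factor [t - s], which has a certificate of its own, and a positive root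
    is double.  In each case the factor is positive on the half line, except at
    a positive root, so the cofactor stays nonnegative; at a positive root this
    follows by continuity. *)
Theorem half_line_nonneg (f : {poly R}) :
  (forall t, 0 < t -> 0 <= f.[t]) -> half_line_cert f.
Proof.
have [n] := ubnP (size f); elim: n f => // n IH f fn f0.
have [f1|f1] := leqP (size f) 1.
  rewrite (size1_polyC f1); apply: half_line_certC.
  by have := f0 1 ltr01; rewrite {1}(size1_polyC f1) hornerC.
have fN0 : f != 0 by rewrite -size_poly_gt0 (leq_trans _ f1).
have step (p g : {poly R}) : f = g * p -> (1 < size p)%N -> half_line_cert p ->
    (forall t, 0 < t -> 0 <= g.[t]) -> half_line_cert f.
  move=> fE p1 cp g0; rewrite fE; apply: half_line_certM cp; apply: IH => //.
  have gN0 : g != 0 by apply: contraNneq fN0 => g0'; rewrite fE g0' mul0r.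
  have pN0 : p != 0 by rewrite -size_poly_gt0 (leq_trans _ p1).
  move: fn; rewrite fE size_mul //; case: (size p) p1 => [|[|k]] // _.
  by rewrite !addnS /= ltnS; apply: leq_ltn_trans; apply: leq_addr.
have [z fz] : exists z, root (cpoly f) z.
  by apply/closed_rootP; rewrite size_map_poly; apply: contraTneq f1 => ->.
have [z0|z0] := eqVneq (complex.Im z) 0; last first.
  have /dvdpP[g fE] := conj_quad_dvd z0 fz.
  apply: (step _ _ fE _ (half_line_cert_quad z)) => [|t t0].
    rewrite -(size_map_poly (real_complex R)) conj_quadE.
    by rewrite size_mul ?polyXsubC_eq0 // !size_XsubC.
  by have := f0 t t0; rewrite fE hornerM pmulr_lge0 // conj_quad_gt0.
have {}fz : root f (complex.Re z).
  move: fz; rewrite -(fmorph_root (real_complex R)); congr (root _ _).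
  by case: z z0 => a b /= ->.
move: (complex.Re z) fz => s {z z0} fs.
have /factor_theorem[g fE] := fs.
have [s0|s0] := leP s 0.
  apply: (step _ _ fE _ (half_line_cert_lin s0)) => [|t t0].
    by rewrite size_XsubC.
  have := f0 t t0; rewrite fE hornerM hornerXsubC pmulr_lge0 // subr_gt0.
  exact: le_lt_trans s0 t0.
(* A positive root is double, as [f] does not change sign there. *)
have g_right t : s < t -> 0 <= g.[t].
  move=> st; have := f0 t (lt_trans s0 st).
  by rewrite fE hornerM hornerXsubC pmulr_lge0 // subr_gt0.
have g_left t : 0 < t < s -> g.[t] <= 0.
  move=> /andP[t0 ts]; have := f0 t t0.
  by rewrite fE hornerM hornerXsubC nmulr_lge0 // subr_lt0.
have /factor_theorem[h gE] : root g s.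
  by rewrite /root eq_le horner_ge0_right // horner_le0_left.
have fE2 : f = h * ('X - s%:P) ^+ 2 by rewrite fE gE -mulrA.
have h_right t : s < t -> 0 <= h.[t].
  move=> st; have := g_right t st.
  by rewrite gE hornerM hornerXsubC pmulr_lge0 // subr_gt0.
apply: (step _ _ fE2 _ (half_line_cert_sqr _)) => [|t t0].
  by rewrite size_exp_XsubC.
have [ts|st|->] := ltgtP t s; [|exact: h_right|exact: horner_ge0_right].
have := g_left t; rewrite t0 ts gE hornerM hornerXsubC nmulr_lle0 ?subr_lt0 //.
exact.
Qed.

End NonnegPolynomials.

(** * From certificates to sums of hermitian squares *)

Section Sufficiency.
Variables (R : realType) (q : R).
Local Notation C := R[i].
Local Notation x := (qgen q).
Local Notation N := (star x * x).

Lemma star_normal : star N = N.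
Proof. by rewrite starM starK. Qed.

(** Since [N] is self-adjoint, the involution only conjugates coefficients. *)
Lemma star_horner_alg (p : {poly C}) :
  star (horner_alg N p) = horner_alg N (map_poly (@Num.conj C) p).
Proof.
have star0 : star (0 : qalg q) = 0.
  by rewrite -(scale0r 0) starZ rmorph0 !scale0r.
elim/poly_ind: p => [|p c IH]; first by rewrite !rmorph0.
rewrite !rmorphD !rmorphM /= map_polyX map_polyC /= !horner_algX !horner_algC.
rewrite starD starM starZ star1 star_normal IH; congr (_ + _).
set r := map_poly _ p.
have E : horner_alg N ('X * r) = horner_alg N (r * 'X) by rewrite mulrC.
by move: E; rewrite !rmorphM /= horner_algX.
Qed.

(** [t |b|^2] becomes [b(N)^* x^* x b(N)], a single hermitian square. *)
Lemma sos_half_line_cert (f : {poly R}) :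
  half_line_cert f -> sos (rpoly_eval f N).
Proof.
move=> [a [b fE]]; exists [:: horner_alg N a; x * horner_alg N b].
rewrite !big_cons big_nil addr0 starM !star_horner_alg /rpoly_eval fE.
set a' := map_poly _ a; set b' := map_poly _ b.
have -> : a * a' + 'X * (b * b') = a' * a + b' * 'X * b by ring.
by rewrite !rmorphD !rmorphM /= horner_algX !mulrA.
Qed.

End Sufficiency.

Theorem proposition7 (R : realType) (q : R) (hq : 0 < q) (f : {poly R}) :
  Aplus (rpoly_eval f (star (qgen q) * qgen q)) ->
  sos (rpoly_eval f (star (qgen q) * qgen q)).
Proof.
by move=> /(Aplus_nonneg hq)/half_line_nonneg; apply: sos_half_line_cert.
Qed.
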